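(* Let $n\in\mathbb{N}$, $n\ge1$, and $\mathbf{x}=(x_1,\dots,x_n)\in\mathbb{N}^{n}$ with all $x_k\ge 1$. Let $$M=\prod_{k=1}^{n}\left(1+4^{n x_k}\right)\qquad\text{and}\qquad s=n\sum_{k=1}^{n}x_k .$$ Then the number of zero partitions of $\mathbf{x}$ (out of all $2^n$ partitions) is encoded as a binary number in the binary digits of $M$ starting at the $s$-th digit and ending at the $(s+n)$-th digit (digits indexed from the least significant, which has index $0$); that is, the number of zero partitions of $\mathbf{x}$ equals $\left\lfloor M/2^{s}\right\rfloor \bmod 2^{n}$.
   Context: A partition of $\mathbf{x}\in\mathbb{N}^n$ is a vector $\sigma\in\{-1,1\}^n$; its size is $\langle\mathbf{x},\sigma\rangle=\sum_{k=1}^n\sigma_k x_k$; it is a zero partition if its size is $0$. *)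

(* Defs.v *)
From mathcomp Require Import all_boot all_order all_algebra.

Set Implicit Arguments.
Unset Strict Implicit.
Unset Printing Implicit Defensive.

Import GRing.Theory.
Local Open Scope ring_scope.

Definition sign : finType := seq_sub [:: -1; 1 : int].

(* A partition of a vector of length n in the sense of the number partitioning
   problem; unrelated to [finset.partition]. *)
Definition spartition (n : nat) : finType := {ffun 'I_n -> sign}.

Definition partition_size (n : nat) (x : 'I_n -> nat) (sigma : spartition n)
  : int := \sum_(k < n) val (sigma k) * (x k)%:Z.

Definition zero_partition (n : nat) (x : 'I_n -> nat) (sigma : spartition n)
  : bool := partition_size x sigma == 0.

Definition num_zero_partitions (n : nat) (x : 'I_n -> nat) : nat :=
  #|[set sigma : spartition n | zero_partition x sigma]|.

(* Digit 0 is the least significant. *)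
Definition bindigit (m i : nat) : nat := ((m %/ 2 ^ i) %% 2)%N.

Lemma card_spartition (n : nat) : #|spartition n| = (2 ^ n)%N.
Proof. by rewrite card_ffun card_ord card_seq_sub. Qed.

(* Main.v *)
(* Expanding the product over sign vectors gives M = \sum_sigma 2 ^ (n * w sigma),
   where w sigma is twice the sum of the x_k with sigma_k = 1, and sigma is a zero
   partition iff w sigma = \sum_k x_k.  In base 2 ^ n the multiplicity of each
   exponent is thus a digit: the all-ones vector has exponent above \sum_k x_k, so
   fewer than 2 ^ n vectors remain for the exponents up to \sum_k x_k and no carry
   reaches, or leaves, that position. *)
Require Import Defs.
From mathcomp Require Import all_boot all_order all_algebra.
From mathcomp Require Import zify.

Import GRing.Theory.

Lemma modn_expn2_bindigit (m n : nat) :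
  (m %% 2 ^ n = \sum_(i < n) bindigit m i * 2 ^ i)%N.
Proof.
elim: n => [|n IHn]; first by rewrite big_ord0 modn1.
rewrite big_ord_recr /= -IHn /bindigit.
(* Writes [m] as [(q * 2 + d) * 2 ^ n + r]; modulo [2 ^ n.+1] the [q] term vanishes. *)
rewrite {1}(divn_eq m (2 ^ n)) {1}(divn_eq (m %/ 2 ^ n) 2).
rewrite mulnDl -mulnA -expnS -addnA modnMDl modn_small; first exact: addnC.
have := ltn_pmod m (expn_gt0 2 n); have := ltn_pmod (m %/ 2 ^ n) (ltn0Sn 1).
by rewrite expnS; nia.
Qed.

Lemma bindigit_div (m s i : nat) : bindigit m (s + i) = bindigit (m %/ 2 ^ s) i.
Proof. by rewrite /bindigit expnD divnMA. Qed.

(** Split the sum by comparing [f i] with [t]: the terms below add up to less than [B ^ t], those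
    above to a multiple of [B ^ t.+1], and those at [t] contribute a digit smaller than [B]. *)
Lemma digit_sum_expn (I : finType) (f : I -> nat) (B t : nat) (i0 : I) :
  (#|I| <= B)%N -> (t < f i0)%N ->
  ((\sum_i B ^ f i) %/ B ^ t %% B = #|[set i | f i == t]|)%N.
Proof.
move=> leIB lt_t_i0.
have B_gt0 : (0 < B)%N by apply: leq_trans leIB; apply/card_gt0P; exists i0.
(* Excluding [i0] makes the bound strict even when [#|I| = B]. *)
have card_lt (P : pred I) : ~~ P i0 -> (#|P| < B)%N.
  move=> nPi0; apply: leq_trans leIB; apply: proper_card.
  by apply/properP; split; [apply/subsetP | exists i0].
have eqE : (\sum_(i | f i == t) B ^ f i = #|[set i | f i == t]| * B ^ t)%N.
  rewrite cardsE -sum_nat_const; apply: eq_bigr => i /eqP-> //.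
have ltE : (\sum_(i | f i < t) B ^ f i < B ^ t)%N.
  case: t lt_t_i0 {eqE} => [|t] lt_t_i0; first by rewrite big_pred0.
  apply: (@leq_ltn_trans (#|[pred i | f i < t.+1]| * B ^ t)%N).
    rewrite -sum_nat_const; apply: leq_sum => i; rewrite ltnS => le_it.
    exact: leq_pexp2l.
  by rewrite expnS ltn_pmul2r ?expn_gt0 ?B_gt0 // card_lt //= -leqNgt ltnW.
have [K gtE] : exists K, (\sum_(i | t < f i) B ^ f i = K * B * B ^ t)%N.
  have /dvdnP[K ->] : (B ^ t.+1 %| \sum_(i | t < f i) B ^ f i)%N.
    by apply: dvdn_sum => i lt_ti; apply: dvdn_exp2l.
  by exists K; rewrite expnS mulnA.
have -> : (\sum_i B ^ f i = (K * B + #|[set i | f i == t]|) * B ^ t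
                            + \sum_(i | f i < t) B ^ f i)%N.
  rewrite mulnDl -gtE -eqE (bigID (fun i => t < f i)%N) /= -addnA; congr addn.
  rewrite (bigID (fun i => f i == t)) /=.
  by congr addn; apply: eq_bigl => i; lia.
rewrite divnMDl ?expn_gt0 ?B_gt0 // divn_small // addn0 modnMDl modn_small //.
by rewrite cardsE card_lt // neq_ltn lt_t_i0 orbT.
Qed.

Lemma sign_pos_subproof : 1%R \in [:: -1; 1 : int]%R. Proof. by []. Qed.
Lemma sign_neg_subproof : (-1)%R \in [:: -1; 1 : int]%R. Proof. by []. Qed.

Definition pos : sign := SeqSub sign_pos_subproof.
Definition neg : sign := SeqSub sign_neg_subproof.

Lemma signP (e : sign) : e = neg \/ e = pos.
Proof.
have := valP e; rewrite !inE => /orP[] /eqP def_e; [left | right]; exact: val_inj.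
Qed.

Lemma sum_sign (F : sign -> nat) : (\sum_e F e = F neg + F pos)%N.
Proof.
rewrite (bigD1 neg) //= (bigD1 pos) //= big_pred0 ?addn0 // => e.
by case: (signP e) => ->.
Qed.

(** The size of [sigma] shifted by the sum of the [x k], so that it is a natural number and can
    serve as an exponent. *)
Definition pos_weight {n : nat} (x : 'I_n -> nat) (sigma : spartition n) : nat :=
  \sum_(k < n) (if sigma k == pos then 2 * x k else 0).

Lemma zero_partition_pos_weight (n : nat) (x : 'I_n -> nat) (sigma : spartition n) :
  zero_partition x sigma = (pos_weight x sigma == \sum_(k < n) x k)%N.
Proof.
rewrite /zero_partition.
have -> : partition_size x sigma
          = ((pos_weight x sigma)%:Z - (\sum_(k < n) x k)%N%:Z)%R.
  rewrite /pos_weight !(big_morph Posz PoszD (erefl _)) -sumrB; apply: eq_bigr => k _.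
  by case: (signP (sigma k)) => -> /=; lia.
by rewrite subr_eq0.
Qed.

(** Distributivity: choosing [1 = b ^ 0] in factor [k] corresponds to [neg], choosing the power to
    [pos]. *)
Lemma prod_pos_weight (n b : nat) (x : 'I_n -> nat) :
  (\prod_(k < n) (1 + b ^ (2 * x k)) = \sum_sigma b ^ pos_weight x sigma)%N.
Proof.
pose F k e := (b ^ (if e == pos then 2 * x k else 0))%N.
transitivity (\prod_(k < n) \sum_e F k e)%N.
  by apply: eq_bigr => k _; rewrite sum_sign.
rewrite bigA_distr_bigA; apply: eq_bigr => sigma _.
by rewrite /pos_weight expn_sum.
Qed.

Theorem theorem4p1 (n : nat) (x : 'I_n -> nat)
    (hn : (1 <= n)%N) (hx : forall k : 'I_n, (1 <= x k)%N) :
  let M := (\prod_(k < n) (1 + 4 ^ (n * x k)))%N in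
  let s := (n * \sum_(k < n) x k)%N in
  num_zero_partitions x = (\sum_(i < n) bindigit M (s + i) * 2 ^ i)%N /\
  num_zero_partitions x = ((M %/ 2 ^ s) %% 2 ^ n)%N.
Proof.
move=> M s.
have numE : num_zero_partitions x = ((M %/ 2 ^ s) %% 2 ^ n)%N.
  have -> : M = (\sum_(sigma : spartition n) (2 ^ n) ^ pos_weight x sigma)%N.
    rewrite -prod_pos_weight; apply: eq_bigr => k _.
    (* Both sides are [2 ^ (2 * (n * x k))], as [4 = 2 ^ 2]. *)
    by rewrite -(expnM 2 2) -expnM mulnCA.
  rewrite expnM (@digit_sum_expn _ _ _ _ [ffun=> pos]) ?card_spartition //.
    apply: eq_card => sigma; rewrite !inE; exact: zero_partition_pos_weight.
  have -> : pos_weight x [ffun=> pos] = (2 * \sum_(k < n) x k)%N.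
    by rewrite big_distrr; apply: eq_bigr => k _; rewrite ffunE eqxx.
  (* Doubling strictly increases the sum of the [x k], which is positive because its term at index 0
     is. *)
  rewrite ltn_Pmull // (bigD1 (Ordinal hn)) //=.
  by rewrite addn_gt0 hx.
split=> //; rewrite numE modn_expn2_bindigit.
by apply: eq_bigr => i _; rewrite bindigit_div.
Qed.
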